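(* Let $(Z,\mathcal{M})$ be an ultrametric Möbius space, and let $(X,d)$ be a geodesically complete tree such that $(\partial_\infty X,\mathcal{M}_X)=(Z,\mathcal{M})$. Let $i:(X,d)\to(\mathcal{M}^a_1,d_{\mathcal{M}^a_1})$ be the map sending $x\in X$ to the Bourdon metric $\rho_x$. Then $i$ is an isometry.
   Context: **Extended metrics.** Let $Z$ be a set with $|Z|\ge 3$. An extended metric on $Z$ is a symmetric map $\rho:Z\times Z\to[0,\infty]$ such that there is a set $\Omega(\rho)\subset Z$ with $|\Omega(\rho)|\in\{0,1\}$, such that $\rho$ restricted to $Z\setminus\Omega(\rho)$ is a metric (with finite values), $\rho(z,\omega)=\infty$ for $z\in Z\setminus\Omega(\rho)$, $\omega\in\Omega(\rho)$, and $\rho(\omega,\omega)=0$ for $\omega \in\Omega(\rho)$. If $\Omega(\rho)=\{\omega\}$, $\omega$ is called the remote point. **Cross ratio triple.** A quadruple $(x,y,z,w)\in Z^4$ is admissible if no entry occurs three or four times. Its cross ratio triple is $$\mathrm{crt}_\rho(x,y,z,w)=(\rho(x,y)\rho(z,w):\rho(x,z)\rho(y,w):\rho(x,w)\rho(y,z))\in\mathbb{R}P^2,$$ with the conventions: if the remote point occurs exactly once, the three (infinite) factors containing it are cancelled, e.g. $\mathrm{crt}_\rho(x,y,z,\omega)=(\rho(x,y):\rho(x,z):\rho(y,z))$; if it occurs twice, the entry in which it is paired with itself is $0$ and the other two entries are equal, e.g. $\mathrm{crt}_\rho(x,y,\omega,\omega)=(0:1:1)$. **Möbius spaces.** Two extended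 metrics on $Z$ are Möbius equivalent if they have the same cross ratio triple on all admissible quadruples. A Möbius structure $\mathcal{M}$ on $Z$ is an equivalence class of Möbius equivalent extended metrics on $Z$; a Möbius space is a pair $(Z,\mathcal{M})$ with $|Z|\ge3$. Put $\mathrm{crt}=\mathrm{crt}_\rho$ for any $\rho\in\mathcal{M}$. A point $(a:b:c)$ with $a,b,c\ge0$ is ultrametric if the two largest of $a,b,c$ coincide; $(Z,\mathcal{M})$ is ultrametric if $\mathrm{crt}(x,y,z,w)$ is ultrametric for all admissible quadruples. **The space $\mathcal{M}^a_1$.** An antipodal diameter 1 metric on $Z$ is a metric $\rho$ on $Z$ (no remote point) with $\mathrm{diam}(Z,\rho)=1$ such that every $z\in Z$ has some $z'\in Z$ with $\rho(z,z')=1$. $\mathcal{M}^a_1\subset\mathcal{M}$ is the subset of antipodal diameter 1 metrics. For $\rho_1,\rho_2\in\mathcal{M}^a_1$ and $\xi\in Z$ put $$\frac{d\rho_1}{d\rho_2}(\xi)=\frac{\rho_1(\eta,\eta')}{\rho_1(\xi,\eta)\rho_1(\xi,\eta')}\cdot\frac{\rho_2(\xi,\eta)\rho_2(\xi,\eta')}{\rho_2(\eta,\eta')},$$ where $\eta,\eta'\in Z\setminus\{\xi\}$ are arbitrary distinct points (the value is independent of this choice). Then $$d_{\mathcal{M}^a_1}(\rho_1,\rho_2)=\sup_{\zeta\in Z}\ln\frac{d\rho_1}{d\rho_2}(\zeta)$$ is a metric on $\mathcal{M}^a_1$. **Trees.** A tree is a metric space $(X,d)$, $|xy|:=d(x,y)$,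 such that (1) any $x,y\in X$ are joined by a unique isometric map $c:[0,d(x,y)]\to X$ with $c(0)=x$, $c(d(x,y))=y$, with image denoted $[x,y]$; (2) if $[x,y]\cap[y,z]=\{y\}$ then $[x,z]=[x,y]\cup[y,z]$. It is geodesically complete if every isometric map $[0,\ell]\to X$, $\ell>0$, extends to an isometric map $\mathbb{R}\to X$. An isometric map is a distance-preserving map; an isometry is a bijective distance-preserving map. **Boundary.** For $x,y,o\in X$ let $(x|y)_o=\frac12(|ox|+|oy|-|xy|)$. A sequence $(x_i)$ in $X$ is a Gromov sequence if $(x_i|x_j)_o\to\infty$ as $i,j\to\infty$ (for some base point $o\in X$); two Gromov sequences are equivalent if $(x_i|y_i)_o\to\infty$. $\partial_\infty X$ is the set of equivalence classes. For $a\ne b$ in $\partial_\infty X$ let $(a|b)_x=\lim_i(a_i|b_i)_x$ for sequences $(a_i),(b_i)$ representing $a,b$ (well defined). The Bourdon metric at $x\in X$ is $\rho_x(a,b)=e^{-(a|b)_x}$ for $a\neq b$, $\rho_x(a,a)=0$. All $\rho_x$, $x\in X$, are Möbius equivalent ultrametrics on $\partial_\infty X$; if $|\partial_\infty X|\ge3$, $\mathcal{M}_X$ denotes the Möbius structure on $\partial_\infty X$ containing them. *)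

(* Defs.v *)
From HB Require Import structures.
From mathcomp Require Import all_boot all_order all_algebra.
From mathcomp Require Import all_classical all_reals all_analysis.
Set Implicit Arguments.
Unset Strict Implicit.
Unset Printing Implicit Defensive.
Import Order.TTheory GRing.Theory Num.Theory.
Import numFieldNormedType.Exports.
Local Open Scope classical_set_scope.
Local Open Scope ring_scope.

Section MoebiusSpaces.
Context {R : realType} {Z : Type}.
Implicit Types rho : Z -> Z -> \bar R.

Definition metric_on (A : set Z) rho : Prop :=
  [/\ forall x y, A x -> A y -> (0 <= rho x y < +oo)%E,
      forall x y, A x -> A y -> (rho x y = 0%E <-> x = y),
      forall x y, A x -> A y -> rho x y = rho y x
    & forall x y z, A x -> A y -> A z -> (rho x z <= rho x y + rho y z)%E].

Definition has_remote_set rho (Omega : set Z) : Prop :=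
  [/\ Omega = set0 \/ exists w, Omega = [set w],
      metric_on (~` Omega) rho,
      forall z w, ~ Omega z -> Omega w -> rho z w = +oo%E
    & forall w, Omega w -> rho w w = 0%E].

Definition extended_metric rho : Prop :=
  [/\ forall x y, (0 <= rho x y)%E,
      forall x y, rho x y = rho y x
    & exists Omega, has_remote_set rho Omega].

(* A point of RP^2 is represented by the set of all its homogeneous
   coordinates, i.e. by a punctured line through the origin of R^3, so that
   equality of points of RP^2 is Leibniz equality. *)
Definition homog (a b c : R) : set (R * R * R) :=
  [set p | exists2 k : R, k != 0 & p = (k * a, k * b, k * c)].

Definition admissible (x y z w : Z) : Prop :=
  [/\ ~ (x = y /\ y = z), ~ (x = y /\ y = w),
      ~ (x = z /\ z = w) & ~ (y = z /\ z = w)].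

(* The factor rho u v is infinite exactly when one and only one of u, v is the
   remote point; such a factor is replaced by 1. If the remote point occurs
   once, each of the three products has exactly one infinite factor, so this
   amounts to cancelling them; if it occurs twice, the product pairing it with
   itself is 0 because rho w w = 0, and both factors of the other two products
   are infinite, which yields (0 : 1 : 1) up to order. *)
Definition crt_factor rho (u v : Z) : R :=
  if rho u v == +oo%E then 1 else fine (rho u v).

Definition crt rho (x y z w : Z) : set (R * R * R) :=
  homog (crt_factor rho x y * crt_factor rho z w)
        (crt_factor rho x z * crt_factor rho y w)
        (crt_factor rho x w * crt_factor rho y z).

Definition moebius_equiv rho1 rho2 : Prop :=
  forall x y z w, admissible x y z w -> crt rho1 x y z w = crt rho2 x y z w.

Definition moebius_class rho : set (Z -> Z -> \bar R) :=
  [set rho' | extended_metric rho' /\ moebius_equiv rho rho'].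

Definition moebius_structure (M : set (Z -> Z -> \bar R)) : Prop :=
  exists2 rho, extended_metric rho & M = moebius_class rho.

Definition moebius_space (M : set (Z -> Z -> \bar R)) : Prop :=
  (exists x y z : Z, [/\ x <> y, y <> z & x <> z]) /\ moebius_structure M.

Definition ultrametric_point (P : set (R * R * R)) : Prop :=
  exists a b c : R, [/\ 0 <= a, 0 <= b, 0 <= c, P = homog a b c
    & [\/ a <= b /\ b = c, b <= a /\ a = c | c <= a /\ a = b]].

Definition ultrametric_structure (M : set (Z -> Z -> \bar R)) : Prop :=
  forall rho, M rho ->
    forall x y z w, admissible x y z w -> ultrametric_point (crt rho x y z w).

Definition antipodal_diameter1 rho : Prop :=
  [/\ metric_on [set: Z] rho,
      ereal_sup [set rho p.1 p.2 | p in [set: Z * Z]] = 1%E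
    & forall z, exists z', rho z z' = 1%E].

Definition Ma1 (M : set (Z -> Z -> \bar R)) : set (Z -> Z -> \bar R) :=
  [set rho | M rho /\ antipodal_diameter1 rho].

(* d rho1 / d rho2 (xi): the common value over all choices of eta, eta'. *)
Definition moebius_deriv rho1 rho2 (xi : Z) : R :=
  xget 0 [set r | forall eta eta' : Z,
    eta <> xi -> eta' <> xi -> eta <> eta' ->
    r = fine (rho1 eta eta') / (fine (rho1 xi eta) * fine (rho1 xi eta'))
        * (fine (rho2 xi eta) * fine (rho2 xi eta') / fine (rho2 eta eta'))].

(* The supremum is taken in the extended reals, where it always exists. *)
Definition dist_Ma1 rho1 rho2 : \bar R :=
  ereal_sup [set (ln (moebius_deriv rho1 rho2 zeta))%:E | zeta in [set: Z]].

End MoebiusSpaces.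

Section Trees.
Context {R : realType} {X : metricType R}.

Definition isometric_on (I : set R) (c : R -> X) : Prop :=
  forall s t, I s -> I t -> mdist (c s) (c t) = `|s - t|.

Definition geodesic (x y : X) (c : R -> X) : Prop :=
  [/\ isometric_on `[0, mdist x y] c, c 0 = x & c (mdist x y) = y].

Definition segment (x y : X) : set X :=
  [set p | exists2 c, geodesic x y c & (c @` `[0, mdist x y]) p].

End Trees.

Section TreePredicates.
Context {R : realType} (X : metricType R).

Definition is_tree : Prop :=
  (forall x y : X, exists2 c, geodesic x y c &
     forall c', geodesic x y c' -> {in `[0, mdist x y], c =1 c'}) /\
  (forall x y z : X, segment x y `&` segment y z = [set y] ->
     segment x z = segment x y `|` segment y z).

Definition geodesically_complete : Prop :=
  forall (l : R) (c : R -> X), 0 < l -> isometric_on `[0, l] c ->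
    exists2 g : R -> X, isometric_on [set: R] g & {in `[0, l], c =1 g}.

End TreePredicates.

Section Boundary.
Context {R : realType} {X : metricType R}.

Definition gromov_product (o x y : X) : R :=
  (mdist o x + mdist o y - mdist x y) / 2.

Definition gromov_seq (u : nat -> X) : Prop :=
  exists o : X,
    gromov_product o (u p.1) (u p.2) @[p --> filter_prod \oo \oo] --> +oo.

Definition gromov_equiv (u v : nat -> X) : Prop :=
  exists o : X, gromov_product o (u i) (v i) @[i --> \oo] --> +oo.

Definition gromov_class (u : nat -> X) : set (nat -> X) :=
  [set v | gromov_seq v /\ gromov_equiv u v].

End Boundary.

Definition boundary (R : realType) (X : metricType R) : Type :=
  {A : set (nat -> X) | exists2 u, gromov_seq u & A = gromov_class u}.

Section Bourdon.
Context {R : realType} {X : metricType R}.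

(* (a|b)_x: the common limit over all sequences representing a and b. *)
Definition boundary_product (x : X) (a b : boundary X) : R :=
  xget 0 [set l | forall u v : nat -> X, sval a u -> sval b v ->
    gromov_product x (u i) (v i) @[i --> \oo] --> l].

Definition bourdon (x : X) (a b : boundary X) : \bar R :=
  if `[< a = b >] then 0%E else (expR (- boundary_product x a b))%:E.

End Bourdon.

(* All bourdon x being Moebius equivalent for a tree X, this union is the single
   equivalence class that contains them. *)
Definition boundary_structure (R : realType) (X : metricType R) :
    set (boundary X -> boundary X -> \bar R) :=
  \bigcup_(x in [set: X]) moebius_class (bourdon x).

Arguments boundary {R} X.
Arguments boundary_structure {R} X.

Definition pullback_metric (R : realType) (Z Y : Type) (phi : Z -> Y)
    (rho : Y -> Y -> \bar R) : Z -> Z -> \bar R :=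
  fun z w => rho (phi z) (phi w).

(* The identification (Z, M) = (Y, N) of Moebius spaces along phi. *)
Definition moebius_identification (R : realType) (Z Y : Type) (phi : Z -> Y)
    (M : set (Z -> Z -> \bar R)) (N : set (Y -> Y -> \bar R)) : Prop :=
  bijective phi /\ M = [set pullback_metric phi rho | rho in N].

(* Main.v *)
Require Import Defs.
From mathcomp Require Import all_boot all_order all_algebra.
From mathcomp Require Import all_classical all_reals all_analysis.
From mathcomp Require Import ring lra.
Set Implicit Arguments.
Unset Strict Implicit.
Import Order.TTheory GRing.Theory Num.Theory.
Import numFieldNormedType.Exports.
Local Open Scope classical_set_scope.
Local Open Scope ring_scope.

(** Three points of a tree have a median ([median_exists]), so the Gromov product
    [(u|v)_x] is the length that the geodesics from [x] to [u] and [v] share, and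
    it satisfies the ultrametric inequality [gromov_product_ultra].  Hence along
    sequences that represent boundary points, Gromov products and differences
    [|x u_i| - |y u_i|] are eventually constant: they define [(a|b)_x] and the
    Busemann function [B_a (x, y)], related by
      [(a|b)_x = (a|b)_y + (B_a (x, y) + B_b (x, y)) / 2].
    Completeness of the tree plays no role: a ray from [x] to [a] is only ever
    used through its points at given finite distances ([ray_point]).

    Distance.  The formula above makes the Bourdon metrics conformal to each
    other, whence [d rho_x / d rho_y (a) = exp (B_a (x, y))].  The Busemann
    function is at most [|xy|], and equality holds for the end of a line that
    prolongs [[x, y]] beyond [y].  So the supremum of the logarithms is [|xy|],
    and the map is distance preserving, in particular injective.

    Image.  A point [x] and a boundary point [a] lie on a common line (follow the
    ray to [a] for a while, turn back, and prolong); its other end is at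
    [rho_x]-distance 1 from [a], so [rho_x] is antipodal of diameter 1.

    Surjectivity.  Let [rho] be antipodal of diameter 1 and Möbius equivalent to
    the Bourdon metrics, and let [rho (a, b) = 1].  For [x] on the line from [a]
    to [b] also [rho_x (a, b) = 1], and sliding [x] along that line achieves
    [rho (a, c) / rho (b, c) = rho_x (a, c) / rho_x (b, c)] for a third point
    [c].  Then [antipodal_rigidity] gives [rho = rho_x]. *)

(** * Betweenness and medians in a tree *)

Section Tree.
Context {R : realType} {X : metricType R}.
Implicit Types (o p q x y z u v : X) (s t : R).

(** Metric betweenness: [y] lies between [x] and [z].  In a tree this is
    membership in the segment [[x, z]] (see [segment_between]); the arguments
    below mostly use this additive form. *)
Definition between x y z := mdist x y + mdist y z = mdist x z.

Lemma mdist_eq0 x y : mdist x y <= 0 -> x = y.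
Proof.
by move=> d_le0; apply: mdist_positivity; apply/eqP; rewrite eq_le d_le0 mdist_ge0.
Qed.

Lemma gromov_product_sym o x y : gromov_product o x y = gromov_product o y x.
Proof. by rewrite /gromov_product [mdist x y]metric_sym [mdist o x + _]addrC. Qed.

Lemma gromov_product_ge0 o x y : 0 <= gromov_product o x y.
Proof.
have := metric_triangle x o y; rewrite /gromov_product [mdist x o]metric_sym.
lra.
Qed.

Lemma gromov_product_le o x y : gromov_product o x y <= mdist o x.
Proof. by have := metric_triangle o x y; rewrite /gromov_product; lra. Qed.

Lemma gromov_productxx o x : gromov_product o x x = mdist o x.
Proof. by rewrite /gromov_product mdistxx; lra. Qed.

Lemma gromov_product_base o p x y :
  gromov_product o x y <= gromov_product p x y + mdist o p.
Proof.
have := metric_triangle o p x; have := metric_triangle o p y.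
rewrite /gromov_product; lra.
Qed.

Lemma geodesic_between x z c t : geodesic x z c -> 0 <= t <= mdist x z ->
  between x (c t) z /\ mdist x (c t) = t.
Proof.
move=> [c_iso cx cz] t_in; have [t_ge0 t_le] := andP t_in.
have d_ge0 := mdist_ge0 x z.
have xt : mdist x (c t) = t.
  by rewrite -{1}cx c_iso ?sub0r ?normrN ?ger0_norm//= in_itv /= ?lexx.
split=> //; rewrite /between xt -{1}cz c_iso /= ?in_itv /= ?lexx ?d_ge0//.
by rewrite ler0_norm; lra.
Qed.

Section Geodesics.
Context (X_tree : is_tree X).

Lemma segment_between x y z : segment x z y <-> between x y z.
Proof.
have sub_between x' y' z' : segment x' z' y' -> between x' y' z'.
  by case=> c gc [t /=]; rewrite in_itv /= => /(geodesic_between gc)[? _] <-.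
have seg_end x' y' : segment x' y' y'.
  have [c gc _] := X_tree.1 x' y'; exists c => //.
  case: gc => _ _ cy; exists (mdist x' y') => //=.
  by rewrite in_itv /= mdist_ge0 lexx.
have seg_start x' y' : segment x' y' x'.
  have [c gc _] := X_tree.1 x' y'; exists c => //.
  case: gc => _ cx _; exists 0 => //=.
  by rewrite in_itv /= mdist_ge0 lexx.
split=> [/sub_between//|xyz].
rewrite (X_tree.2 x y z); first by left; exact: seg_end.
apply/seteqP; split=> [q [/sub_between xqy /sub_between yqz]|q ->]; last first.
  by split; [exact: seg_end|exact: seg_start].
apply/mdist_eq0; have := metric_triangle x q z.
move: xyz xqy yqz; rewrite /between [mdist y q]metric_sym; lra.
Qed.

(** Every pair of points is joined by a geodesic that contains all the points
    between them; so such a point is determined by its distance to one end. *)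
Lemma between_geodesic x z : exists2 c : R -> X, geodesic x z c &
  forall y, between x y z -> y = c (mdist x y).
Proof.
have [c gc c_unique] := X_tree.1 x z; exists c => // y /segment_between.
case=> c' gc' [t /=]; rewrite in_itv /= => t_in <-.
have [_ ->] := geodesic_between gc' t_in.
by rewrite (c_unique _ gc') ?in_itv.
Qed.

Lemma mdist_between x y y' z : between x y z -> between x y' z ->
  mdist y y' = `|mdist x y - mdist x y'|.
Proof.
have [c [c_iso _ _] cE] := between_geodesic x z.
move=> xyz xy'z; rewrite {1}(cE _ xyz) {1}(cE _ xy'z) c_iso//=.
- by rewrite in_itv /= mdist_ge0 -xyz lerDl mdist_ge0.
- by rewrite in_itv /= mdist_ge0 -xy'z lerDl mdist_ge0.
Qed.

Lemma between_exists x z t : 0 <= t <= mdist x z ->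
  exists2 y, between x y z & mdist x y = t.
Proof.
move=> t_in.
have [c gc _] := X_tree.1 x z.
by have [] := geodesic_between gc t_in; exists (c t).
Qed.

(** Any three points of a tree have a median: the last point that the
    geodesics from [x] to [y] and from [x] to [z] have in common. *)
Lemma median_exists x y z :
  exists m, [/\ between x m y, between x m z & between y m z].
Proof.
have [c gc cE] := between_geodesic x y; have [c_iso cx _] := gc.
have [c' gc' c'E] := between_geodesic x z; have [c'_iso c'x _] := gc'.
have dxy := mdist_ge0 x y; have dxz := mdist_ge0 x z.
pose common := [set t | [/\ 0 <= t, t <= mdist x y, t <= mdist x z & c t = c' t]].
have common0 : common 0 by split=> //; rewrite cx c'x.
have common_sup : has_sup common.
  by split; [exists 0|exists (mdist x y) => t []].
pose T := sup common.
have T_ge0 : 0 <= T by exact: sup_upper_bound.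
have T_ley : T <= mdist x y by apply: ge_sup; [exists 0|move=> t []].
have T_lez : T <= mdist x z by apply: ge_sup; [exists 0|move=> t []].
(* the common times are closed because both geodesics are 1-Lipschitz *)
have cT : c T = c' T.
  apply/mdist_eq0/ler_addgt0Pl => e e_gt0; rewrite addr0.
  have e2_gt0 : 0 < e / 2 by rewrite divr_gt0.
  have [t [t_ge0 t_ley t_lez ct] t_gt] := sup_adherent e2_gt0 common_sup.
  have t_leT : t <= T by exact: sup_upper_bound.
  have := metric_triangle (c T) (c t) (c' T).
  rewrite {2}ct c_iso ?c'_iso //= ?in_itv /= ?T_ge0 ?t_ge0//.
  by rewrite ger0_norm ?ler0_norm /=; move: t_gt; rewrite -/T; lra.
have [xTy dxT] : between x (c T) y /\ mdist x (c T) = T.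
  by apply: (geodesic_between gc); rewrite T_ge0.
have [xTz _] : between x (c T) z /\ mdist x (c T) = T.
  by rewrite cT; apply: (geodesic_between gc'); rewrite T_ge0.
(* [y, m] and [m, z] meet only in m, as m is the last common point *)
exists (c T); split=> //; apply/segment_between.
rewrite (X_tree.2 y (c T) z); last first.
  apply/seteqP; split=> [q [/segment_between yqT /segment_between Tqz]|q ->].
    have xq : mdist x q = T + mdist (c T) q.
      have := metric_triangle x q y; have := metric_triangle x (c T) q.
      move: yqT xTy; rewrite /between dxT [mdist y q]metric_sym.
      rewrite [mdist y (c T)]metric_sym [mdist q (c T)]metric_sym.
      lra.
    have xqy : between x q y.
      move: yqT xTy; rewrite /between dxT xq [mdist y q]metric_sym.
      rewrite [mdist y (c T)]metric_sym [mdist q (c T)]metric_sym; lra.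
    have xqz : between x q z.
      by move: Tqz xTz; rewrite /between dxT xq; lra.
    have /(sup_upper_bound common_sup) : common (mdist x q).
      split; rewrite ?mdist_ge0 -?cE -?c'E//.
        by rewrite -xqy lerDl mdist_ge0.
      by rewrite -xqz lerDl mdist_ge0.
    by rewrite -/T xq => Tq; apply/mdist_eq0; rewrite metric_sym; lra.
  by split; apply/segment_between; rewrite /between mdistxx; lra.
by left; apply/segment_between; rewrite /between mdistxx; lra.
Qed.

(** The Gromov product measures how long the geodesics from [x] to [u] and to
    [v] stay together. *)
Lemma between_switch x y u v : between x y u -> mdist x y <= gromov_product x u v ->
  between x y v.
Proof.
have [m [xmu xmv umv]] := median_exists x u v.
move=> xyu; have := mdist_between xyu xmu.
have := metric_triangle x y v; have := metric_triangle y m v.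
move: xmu xmv umv; rewrite /between /gromov_product [mdist u m]metric_sym.
move=> xmu xmv umv yv xv ym xy_le.
by move: ym; rewrite ler0_norm; lra.
Qed.

Lemma gromov_product_ultra o x y z t :
  t <= gromov_product o x y -> t <= gromov_product o y z ->
  t <= gromov_product o x z.
Proof.
wlog le_xyz : x z / gromov_product o x y <= gromov_product o y z => [H|].
  have [/H//|/ltW] := leP (gromov_product o x y) (gromov_product o y z).
  rewrite [gromov_product o x y]gromov_product_sym.
  rewrite [gromov_product o y z]gromov_product_sym => /H {}H txy tyz.
  by rewrite gromov_product_sym; exact: H.
move=> txy _; apply: (le_trans txy); move: le_xyz.
have [m [omx omy xmy]] := median_exists o x y.
have om : mdist o m = gromov_product o x y.
  by move: omx omy xmy; rewrite /between /gromov_product [mdist x m]metric_sym; lra.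
rewrite -om => /(between_switch omy) omz.
have := metric_triangle x m z; move: omx omz.
by rewrite /between /gromov_product [mdist x m]metric_sym; lra.
Qed.

(** Of three Gromov products, the smallest is attained twice. *)
Lemma gromov_product_eql o x y z : gromov_product o x y < gromov_product o y z ->
  gromov_product o x z = gromov_product o x y.
Proof.
move=> xy_lt; apply/eqP; rewrite eq_le; apply/andP; split; last first.
  by apply: (gromov_product_ultra (lexx _)); rewrite ltW.
rewrite leNgt; apply/negP => xz_gt.
have := @gromov_product_ultra o x z y
  (Num.min (gromov_product o x z) (gromov_product o y z)).
rewrite ge_min lexx [gromov_product o z y]gromov_product_sym ge_min lexx orbT.
by move=> /(_ isT isT); rewrite ge_min !leNgt xz_gt xy_lt.
Qed.

End Geodesics.
End Tree.

(** * Gromov products and Busemann functions at infinity *)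

(** The Busemann function [B_a (x, y) = lim_i |x u_i| - |y u_i|] of the boundary
    point [a], for any sequence [u] representing [a]: the difference is
    eventually constant in a tree, so the limit is encoded as this constant. *)
Definition busemann (R : realType) (X : metricType R) (x y : X)
    (a : boundary X) : R :=
  xget 0 [set l | forall u, sval a u ->
    \forall i \near \oo, mdist x (u i) - mdist y (u i) = l].

Section BoundaryAtInfinity.
Context {R : realType} {X : metricType R}.
Implicit Types (o p x y z : X) (u v w : nat -> X) (a b c : boundary X).

Lemma gromov_seqP u o (K : R) : gromov_seq u ->
  exists N, forall i j, (N <= i)%N -> (N <= j)%N -> K < gromov_product o (u i) (u j).
Proof.
case=> p /cvgryPgt/(_ (K + mdist p o)) [[A B] /= [[N1 _ AN1] [N2 _ BN2]] AB].
exists (maxn N1 N2) => i j; rewrite !geq_max => /andP[i1 _] /andP[_ j2].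
have /= := AB (i, j) (conj (AN1 _ i1) (BN2 _ j2)).
by have := gromov_product_base p o (u i) (u j); lra.
Qed.

Lemma gromov_equivP u v o (K : R) : gromov_equiv u v ->
  \forall i \near \oo, K < gromov_product o (u i) (v i).
Proof.
case=> p /cvgryPgt/(_ (K + mdist p o)); apply: filterS => i.
by have := gromov_product_base p o (u i) (v i); lra.
Qed.

Lemma gromov_seq_equiv u (x0 : X) : gromov_seq u -> gromov_equiv u u.
Proof.
move=> gu; exists x0; apply/cvgryPgt => K; have [N NP] := gromov_seqP x0 K gu.
by exists N => // i /= Ni; exact: NP.
Qed.

Lemma gromov_equiv_sym u v : gromov_equiv u v -> gromov_equiv v u.
Proof.
case=> o uv; exists o; rewrite (_ : (fun i => _) =
  (fun i => gromov_product o (u i) (v i))) //.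
by apply/funext => i; rewrite gromov_product_sym.
Qed.

Lemma boundary_gromov a u : sval a u -> gromov_seq u.
Proof. by case: a => A /= [w _ ->] []. Qed.

Lemma boundary_rep a : exists u, sval a u.
Proof.
case: a => A /= [u gu ->]; exists u; split=> //.
by case: (gu) => o _; exact: (gromov_seq_equiv o).
Qed.

Section InTree.
Context (X_tree : is_tree X).

Lemma gromov_equiv_trans u v w :
  gromov_equiv u v -> gromov_equiv v w -> gromov_equiv u w.
Proof.
move=> uv vw; have [p _] := uv; exists p; apply/cvgryPge => K.
near=> i; apply: (gromov_product_ultra X_tree (y := v i)); apply/ltW; near: i.
  exact: gromov_equivP.
exact: gromov_equivP.
Unshelve. all: by end_near. Qed.

Lemma boundary_equiv a u v : sval a u -> sval a v -> gromov_equiv u v.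
Proof.
case: a => A /= [w _ ->] [_ wu] [_ wv].
exact: gromov_equiv_trans (gromov_equiv_sym wu) wv.
Qed.

Lemma boundary_eq a b u v : sval a u -> sval b v -> gromov_equiv u v -> a = b.
Proof.
case: a b => A pA [B pB] /= Au Bv uv.
suff AB : A = B by subst B; congr exist; exact: Prop_irrelevance.
have [w _ Aw] := pA; have [w' _ Bw'] := pB; subst A B.
have ww' : gromov_equiv w w'.
  apply: gromov_equiv_trans Au.2 _; apply: gromov_equiv_trans uv _.
  exact: gromov_equiv_sym Bv.2.
apply/seteqP; split=> t [gt te]; split=> //.
  exact: gromov_equiv_trans (gromov_equiv_sym ww') te.
exact: gromov_equiv_trans ww' te.
Qed.

(** By the ultrametric inequality, the Gromov products of two sequences that
    converge to distinct boundary points are eventually constant. *)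
Lemma gromov_product_stable a b u v x : a <> b -> sval a u -> sval b v ->
  exists l, \forall i \near \oo, gromov_product x (u i) (v i) = l.
Proof.
move=> ab au bv.
have /existsNP[K /= notK] : ~ forall K, \forall i \near \oo,
    K < gromov_product x (u i) (v i).
  by move=> uv; apply: ab; apply: (boundary_eq au bv); exists x; apply/cvgryPgt.
have [N1 uN1] := gromov_seqP x K (boundary_gromov au).
have [N2 vN2] := gromov_seqP x K (boundary_gromov bv).
have [i0 [i01 i02 i0K]] : exists i0, [/\ (N1 <= i0)%N, (N2 <= i0)%N &
    gromov_product x (u i0) (v i0) <= K].
  apply: contrapT => none; apply: notK; exists (maxn N1 N2) => // i /=.
  rewrite geq_max => /andP[i1 i2]; rewrite ltNge; apply/negP => iK.
  by apply: none; exists i.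
exists (gromov_product x (u i0) (v i0)); exists (maxn N1 N2) => // i /=.
rewrite geq_max => /andP[i1 i2].
have e1 : gromov_product x (u i0) (v i) = gromov_product x (u i0) (v i0).
  by apply: (gromov_product_eql X_tree); apply: le_lt_trans i0K (vN2 _ _ i02 i2).
rewrite gromov_product_sym -e1 [RHS]gromov_product_sym.
apply: (gromov_product_eql X_tree).
by rewrite gromov_product_sym e1; apply: le_lt_trans i0K (uN1 _ _ i01 i1).
Qed.

Lemma boundary_productE a b u v x : a <> b -> sval a u -> sval b v ->
  \forall i \near \oo, gromov_product x (u i) (v i) = boundary_product x a b.
Proof.
move=> ab au bv; have [l uvl] := gromov_product_stable x ab au bv.
suff -> : boundary_product x a b = l by [].
have uv_cvg : gromov_product x (u i) (v i) @[i --> \oo] --> l.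
  by apply: cvg_near_cst.
rewrite /boundary_product; case: xgetP => [l' _ /(_ u v au bv) bp_cvg|/(_ l) []].
  exact: (cvg_unique _ bp_cvg uv_cvg).
move=> u' v' au' bv'; apply: cvg_near_cst; near=> i.
have uvi : gromov_product x (u i) (v i) = l by near: i.
have vv'i : l < gromov_product x (v i) (v' i).
  by near: i; apply: gromov_equivP; exact: (boundary_equiv bv bv').
have uu'i : l < gromov_product x (u i) (u' i).
  by near: i; apply: gromov_equivP; exact: (boundary_equiv au au').
have e1 : gromov_product x (u i) (v' i) = l.
  by rewrite (gromov_product_eql X_tree (y := v i)) uvi.
rewrite gromov_product_sym (gromov_product_eql X_tree (y := u i)).
  by rewrite gromov_product_sym.
by rewrite gromov_product_sym e1.
Unshelve. all: by end_near. Qed.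

Lemma busemannE a u x y : sval a u ->
  \forall i \near \oo, mdist x (u i) - mdist y (u i) = busemann x y a.
Proof.
move=> au; rewrite /busemann; case: xgetP => [l _ /(_ _ au)//|none].
exfalso.
have [w aw] := boundary_rep a.
have [N wN] := gromov_seqP x (mdist x y) (boundary_gromov aw).
apply: (none (mdist x (w N) - mdist y (w N))) => v av; near=> i.
have le_xy z : gromov_product x y z <= mdist x y by exact: gromov_product_le.
have wNi : mdist x y < gromov_product x (w N) (w i).
  by apply: wN => //; near: i; exact: nbhs_infty_ge.
have wvi : mdist x y < gromov_product x (w i) (v i).
  by near: i; apply: gromov_equivP; exact: (boundary_equiv aw av).
have : gromov_product x y (v i) = gromov_product x y (w N).
  rewrite (gromov_product_eql X_tree (y := w i)) ?(le_lt_trans (le_xy _))//.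
  by rewrite (gromov_product_eql X_tree (y := w N)) ?(le_lt_trans (le_xy _)).
by rewrite /gromov_product; lra.
Unshelve. all: by end_near. Qed.

Lemma busemann_le x y a : busemann x y a <= mdist x y.
Proof.
have [u au] := boundary_rep a; have [N _ NP] := busemannE x y au.
by rewrite -(NP N (leqnn N)) /=; have := metric_triangle x y (u N); lra.
Qed.

Lemma busemann_anti x y a : busemann y x a = - busemann x y a.
Proof.
have [u au] := boundary_rep a.
have [N _ NP] := filterI (busemannE x y au) (busemannE y x au).
by have [/=<- <-] := NP N (leqnn N); lra.
Qed.

Lemma boundary_product_sym x a b :
  boundary_product x a b = boundary_product x b a.
Proof.
case: (pselect (a = b)) => [->//|ab].
have [u au] := boundary_rep a; have [v bv] := boundary_rep b.
have [N _ NP] := filterI (boundary_productE x ab au bv)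
  (boundary_productE x (nesym ab) bv au).
by have [/= <- <-] := NP N (leqnn N); rewrite gromov_product_sym.
Qed.

Lemma boundary_product_ge0 x a b : a <> b -> 0 <= boundary_product x a b.
Proof.
move=> ab; have [u au] := boundary_rep a; have [v bv] := boundary_rep b.
have [N _ NP] := boundary_productE x ab au bv.
by rewrite -(NP N (leqnn N)) gromov_product_ge0.
Qed.

Lemma boundary_product_ultra x a b c t : a <> b -> b <> c -> a <> c ->
  t <= boundary_product x a b -> t <= boundary_product x b c ->
  t <= boundary_product x a c.
Proof.
move=> ab bc ac.
have [u au] := boundary_rep a; have [v bv] := boundary_rep b.
have [w cw] := boundary_rep c.
have [N _ NP] := filterI (boundary_productE x ab au bv)
  (filterI (boundary_productE x bc bv cw) (boundary_productE x ac au cw)).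
have [/= <- [<- <-]] := NP N (leqnn N); exact: gromov_product_ultra.
Qed.

Lemma boundary_product_busemann x y a b : a <> b ->
  boundary_product x a b =
  boundary_product y a b + (busemann x y a + busemann x y b) / 2.
Proof.
move=> ab; have [u au] := boundary_rep a; have [v bv] := boundary_rep b.
have [N _ NP] := filterI
  (filterI (boundary_productE x ab au bv) (boundary_productE y ab au bv))
  (filterI (busemannE x y au) (busemannE x y bv)).
have [/= [<- <-] [<- <-]] := NP N (leqnn N).
by rewrite /gromov_product; lra.
Qed.

(** * Rays and lines *)

(** The equality [busemann x y a = mdist x y] says that [y] lies on the geodesic
    ray from [x] to [a]; such points exist at every distance [s]. *)

Lemma ray_point x a (s : R) : 0 <= s ->
  exists2 y, mdist x y = s & busemann x y a = s.
Proof.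
move=> s_ge0; have [u au] := boundary_rep a.
have [N uN] := gromov_seqP x s (boundary_gromov au).
have [|y xyu xy] := @between_exists _ _ X_tree x (u N) s.
  by rewrite s_ge0 -(gromov_productxx x) ltW// uN.
exists y => //; have [N' _ N'P] := busemannE x y au.
rewrite -(N'P (maxn N N')) /= ?leq_maxr//.
have : between x y (u (maxn N N')).
  by apply: (between_switch X_tree xyu); rewrite xy ltW// uN ?leq_maxl.
by rewrite /between xy; lra.
Qed.

(** The rays from [x] to [a] and [b] agree up to the time [(a|b)_x]. *)
Lemma busemann_switch x y a b : a <> b -> busemann x y a = mdist x y ->
  mdist x y <= boundary_product x a b -> busemann x y b = mdist x y.
Proof.
move=> ab; have [u au] := boundary_rep a; have [v bv] := boundary_rep b.
have [N _ NP] := filterI (boundary_productE x ab au bv)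
  (filterI (busemannE x y au) (busemannE x y bv)).
have [/= <- [<- <-]] := NP N (leqnn N) => xyu.
have {xyu} xyu : between x y (u N) by rewrite /between -xyu; lra.
by move=> /(between_switch X_tree xyu); rewrite /between; lra.
Qed.

(** The equality [boundary_product p a b = 0] says that [p] lies on the line
    from [a] to [b]; the branching point of the rays from [x] is such a point. *)
Lemma line_point_exists x a b : a <> b -> exists p, boundary_product p a b = 0.
Proof.
move=> ab; have [p xp pa] := ray_point x a (boundary_product_ge0 x ab).
exists p; have := boundary_product_busemann x p ab; rewrite pa.
by rewrite (busemann_switch ab) ?xp ?pa//; lra.
Qed.

(** Moving a point of the line from [a] to [b] by a signed length [t] towards
    [b]; the result lies again on the line, by [boundary_product_busemann]. *)
Lemma line_point_shift p a b (t : R) : a <> b -> boundary_product p a b = 0 ->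
  exists x, busemann p x a = - t /\ busemann p x b = t.
Proof.
wlog t_ge0 : t a b / 0 <= t => [H|].
  have [|/ltW t_le0 ab pab] := leP 0 t; first exact: H.
  have [| | |x [xb xa]] := H (- t) b a.
  - by lra.
  - exact: nesym.
  - by rewrite boundary_product_sym.
  by exists x; rewrite xa xb opprK.
move=> ab pab; have [x px pxb] := ray_point p b t_ge0; exists x; split=> //.
(* both bounds on [busemann p x a]: [x] is at distance [t] from [p], and
   [(a|b)_x >= 0] *)
have := boundary_product_ge0 x ab; have := busemann_le x p a.
rewrite (boundary_product_busemann x p ab) pab !(busemann_anti p x) pxb.
by rewrite metric_sym px; lra.
Qed.

Section Complete.
Context (X_gc : geodesically_complete X).

(** Every nondegenerate geodesic can be prolonged to a ray: some end of the tree lies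
    beyond [y] as seen from [x]. *)
Lemma ray_extension x y : x <> y -> exists a, busemann x y a = mdist x y.
Proof.
move=> /eqP; rewrite -mdist_gt0 => xy_gt0.
have [c gc _] := X_tree.1 x y; have [c_iso cx cy] := gc.
have [g g_iso cg] := X_gc xy_gt0 c_iso.
have gx : g 0 = x by rewrite -cg ?cx// in_itv /= lexx ltW.
have gy : g (mdist x y) = y by rewrite -cg ?cy// in_itv /= lexx ltW.
pose u (i : nat) := g (mdist x y + i%:R).
have yu i : mdist y (u i) = i%:R.
  by rewrite -{1}gy g_iso// opprD addNKr normrN ger0_norm.
have xu i : mdist x (u i) = mdist x y + i%:R.
  by rewrite -{1}gx g_iso// sub0r normrN ger0_norm// addr_ge0// ltW.
have uu i j : (i <= j)%N -> gromov_product y (u i) (u j) = i%:R.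
  rewrite -(ler_nat R) => ij; rewrite /gromov_product !yu g_iso// ler0_norm; lra.
have gu : gromov_seq u.
  exists y; apply/cvgryPge => K.
  have [n Kn] : exists n : nat, K <= n%:R.
    by exists (Num.truncn K).+1; exact/ltW/truncnS_gt.
  exists (([set i | (n <= i)%N], [set i | (n <= i)%N])).
    by split; exact: nbhs_infty_ge.
  move=> [i j] /= [ni nj]; apply: (le_trans Kn).
  have [ij|/ltnW ji] := leqP i j; first by rewrite uu// ler_nat.
  by rewrite gromov_product_sym uu// ler_nat.
exists (exist _ (gromov_class u) (ex_intro2 _ _ u gu erefl)).
set a := exist _ _ _.
have au : sval a u by split=> //; exact: (gromov_seq_equiv x).
have [N _ NP] := busemannE x y au.
by rewrite -(NP N (leqnn N)) xu yu; lra.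
Qed.

(** Following the ray to [a] for a unit of time and then turning back gives a
    line through [x] that ends at [a]. *)
Lemma antipode_exists x a : exists2 b, a <> b & boundary_product x a b = 0.
Proof.
have [y xy xya] := ray_point x a (@ler01 R).
have [b] : exists b, busemann y x b = mdist y x.
  apply: ray_extension => yx; move: xy; rewrite yx mdistxx => /eqP.
  by rewrite eq_sym oner_eq0.
rewrite metric_sym xy => yxb.
have ab : a <> b by move=> ab; move: xya; rewrite ab busemann_anti; lra.
exists b => //.
have [u au] := boundary_rep a; have [v bv] := boundary_rep b.
have [N _ NP] := filterI (boundary_productE x ab au bv)
  (filterI (busemannE x y au) (busemannE y x bv)).
move: xya yxb; have [/= <- [<- <-]] := NP N (leqnn N) => xyu yxv.
have vy : gromov_product x (v N) y = 0.
  by rewrite /gromov_product [mdist (v N) y]metric_sym xy; lra.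
rewrite gromov_product_sym (gromov_product_eql X_tree (y := y))// vy.
by rewrite /gromov_product xy; lra.
Qed.

End Complete.
End InTree.
End BoundaryAtInfinity.

(** * Möbius equivalence of metrics without remote point *)

Section MoebiusEquivalence.
Context {R : realType} {T : Type}.
Implicit Types (rho sigma tau : T -> T -> \bar R) (x y z w : T).

Lemma metric_on_extended rho : metric_on [set: T] rho -> extended_metric rho.
Proof.
move=> rho_metric; have [rho_fin _ rho_sym _] := rho_metric; split.
- by move=> x y; have /andP[] := rho_fin x y I I.
- by move=> x y; exact: rho_sym.
- by exists set0; split; rewrite ?setC0//; left.
Qed.

Lemma metric_on_fin rho : metric_on [set: T] rho ->
  forall x y, rho x y = (fine (rho x y))%:E.
Proof.
by move=> [rho_fin _ _ _] x y; rewrite fineK// ge0_fin_numE;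
  have /andP[] := rho_fin x y I I.
Qed.

Lemma crt_factor_fine rho x y : metric_on [set: T] rho ->
  crt_factor rho x y = fine (rho x y).
Proof. by move=> /metric_on_fin rho_fin; rewrite /crt_factor rho_fin. Qed.

Lemma homogZ (k a b c : R) : k != 0 ->
  homog (k * a) (k * b) (k * c) = homog a b c.
Proof.
move=> k_neq0; apply/seteqP; split=> p [j j_neq0 ->].
  by exists (j * k); rewrite ?mulf_neq0// !mulrA.
by exists (j / k); rewrite ?mulf_neq0 ?invr_eq0// !mulrA !divfK.
Qed.

Lemma homog_eq (a b c a' b' c' : R) : homog a b c = homog a' b' c' ->
  exists k, [/\ k != 0, a' = k * a, b' = k * b & c' = k * c].
Proof.
move=> abc; have : homog a b c (a', b', c').
  by rewrite abc; exists 1; rewrite ?oner_eq0// !mul1r.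
by case=> k k_neq0 [-> -> ->]; exists k.
Qed.

Lemma moebius_equiv_fine rho sigma : metric_on [set: T] rho ->
  metric_on [set: T] sigma -> moebius_equiv sigma rho ->
  forall x y z w, admissible x y z w -> exists k, [/\ k != 0,
    fine (rho x y) * fine (rho z w) = k * (fine (sigma x y) * fine (sigma z w)),
    fine (rho x z) * fine (rho y w) = k * (fine (sigma x z) * fine (sigma y w)) &
    fine (rho x w) * fine (rho y z) = k * (fine (sigma x w) * fine (sigma y z))].
Proof.
move=> mrho msigma equiv x y z w /equiv /homog_eq.
by rewrite !crt_factor_fine.
Qed.

(** A conformal change of a metric does not affect cross ratios. *)
Lemma conformal_moebius_equiv rho sigma (lambda : T -> R) :
  metric_on [set: T] rho -> metric_on [set: T] sigma ->
  (forall x, lambda x != 0) ->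
  (forall x y, fine (rho x y) = lambda x * lambda y * fine (sigma x y)) ->
  moebius_equiv rho sigma.
Proof.
move=> mrho msigma l_neq0 rhoE x y z w _; rewrite /crt !crt_factor_fine// !rhoE.
rewrite -[RHS](@homogZ (lambda x * lambda y * lambda z * lambda w)) ?mulf_neq0//.
by congr homog; ring.
Qed.

Lemma moebius_equiv_trans rho sigma tau :
  moebius_equiv rho sigma -> moebius_equiv sigma tau -> moebius_equiv rho tau.
Proof. by move=> rs st x y z w adm; rewrite rs// st. Qed.

Lemma antipodal_le1 rho : antipodal_diameter1 rho -> forall x y, fine (rho x y) <= 1.
Proof.
move=> [/metric_on_fin rho_fin rho_sup _] x y.
have : (rho x y <= 1)%E.
  by rewrite -rho_sup; apply: ereal_sup_ubound; exists (x, y).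
by rewrite rho_fin lee_fin.
Qed.

(** Rigidity: an antipodal metric of diameter 1 is determined by its Möbius
    class, two points at distance 1 and the quotient of their distances to a
    third one.  Fixing [a], [b] at distance 1 for both metrics,
    equality of the cross ratios gives [rho c d = L c * L d * sigma c d] for the
    factor [L d = rho a d / sigma a d].  Since [sigma] is an ultrametric, one of
    [sigma a d], [sigma b d] is at least 1, and [rho <= 1] forces [L <= 1]; since
    each [d] has a point at [rho]-distance 1, also [L d >= 1]. *)
Lemma antipodal_rigidity rho sigma (a b c : T) :
  antipodal_diameter1 rho -> metric_on [set: T] sigma ->
  (forall x y, fine (sigma x y) <= 1) ->
  (forall x y z, fine (sigma x z) <= Num.max (fine (sigma x y)) (fine (sigma y z))) ->
  moebius_equiv sigma rho ->
  c <> a -> c <> b -> fine (rho a b) = 1 -> fine (sigma a b) = 1 ->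
  fine (rho a c) * fine (sigma b c) = fine (rho b c) * fine (sigma a c) ->
  rho = sigma.
Proof.
move=> rho_anti msigma s_le1 s_ultra equiv ca cb rab sab rsc.
have [mrho _ rho_anti1] := rho_anti.
pose r x y := fine (rho x y); pose s x y := fine (sigma x y).
suff rs_eq : forall x y, r x y = s x y.
  apply/funext => x; apply/funext => y.
  rewrite (metric_on_fin mrho) (metric_on_fin msigma); congr EFin; exact: rs_eq.
have r_le1 : forall x y, r x y <= 1 := antipodal_le1 rho_anti.
have r_anti d : exists d', r d d' = 1.
  by have [d' dd'] := rho_anti1 d; exists d'; rewrite /r dd'.
have {}equiv : forall x y z w, admissible x y z w -> exists k, [/\ k != 0,
    r x y * r z w = k * (s x y * s z w), r x z * r y w = k * (s x z * s y w) &
    r x w * r y z = k * (s x w * s y z)] := moebius_equiv_fine mrho msigma equiv.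
have fine_metric tau : metric_on [set: T] tau -> [/\
    forall x y, fine (tau x y) = fine (tau y x), forall x, fine (tau x x) = 0 &
    forall x y, x <> y -> 0 < fine (tau x y)].
  move=> mtau; have tau_fin := metric_on_fin mtau.
  have [tau_ge0 tau0 tau_sym _] := mtau; split.
  - by move=> x y; rewrite tau_sym.
  - by move=> x; rewrite (tau0 x x I I).2.
  - move=> x y xy; rewrite lt_neqAle eq_sym -lee_fin -tau_fin.
    have /andP[-> _] := tau_ge0 x y I I; rewrite andbT.
    by apply/eqP => txy; apply: xy; apply/tau0 => //; rewrite tau_fin txy.
have [] : [/\ forall x y, r x y = r y x, forall x, r x x = 0 &
    forall x y, x <> y -> 0 < r x y] := fine_metric _ mrho.
have [] : [/\ forall x y, s x y = s y x, forall x, s x x = 0 &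
    forall x y, x <> y -> 0 < s x y] := fine_metric _ msigma.
have {}s_le1 : forall x y, s x y <= 1 := s_le1.
have {}s_ultra : forall x y z, s x z <= Num.max (s x y) (s y z) := s_ultra.
have {}rab : r a b = 1 := rab; have {}sab : s a b = 1 := sab.
have {}rsc : r a c * s b c = r b c * s a c := rsc.
clearbody r s; move=> s_sym sxx s_gt0 r_sym rxx r_gt0.
have ab : a <> b.
  by move=> ab; move: rab; rewrite ab rxx => /eqP; rewrite eq_sym oner_eq0.
(* compares the last two entries of the cross ratio triples of (a, b, c, d) *)
have rs d : r a d * s b d = r b d * s a d.
  have [|k [k_neq0 _ e1 e2]] := equiv a b c d; first by split=> -[]; congruence.
  have m_neq0 : k * (r b c * s a c) != 0.
    by rewrite !mulf_neq0// gt_eqF// ?r_gt0 ?s_gt0//; exact: nesym.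
  apply: (mulIf m_neq0).
  transitivity ((r a d * r b c) * (k * (s a c * s b d))); first by ring.
  rewrite -e1 e2.
  transitivity (k * s a d * r b d * (r a c * s b c)); first by ring.
  by rewrite rsc; ring.
(* at [a] the quotient is undefined; the value 1 agrees with [rho b a / sigma b a] *)
pose L d := if `[< d = a >] then 1 else r a d / s a d.
have L_gt0 d : 0 < L d.
  by rewrite /L; case: asboolP => // /nesym ad; rewrite divr_gt0 ?r_gt0 ?s_gt0.
have raE d : r a d = L d * s a d.
  rewrite /L; case: asboolP => [->|/nesym ad]; first by rewrite rxx sxx mulr0.
  by rewrite divfK// gt_eqF// s_gt0.
have rbE d : r b d = L d * s b d.
  rewrite /L; case: asboolP => [->|/nesym ad].
    by rewrite r_sym s_sym rab sab mulr1.
  by rewrite mulrAC rs mulfK// gt_eqF// s_gt0.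
have rE x y : r x y = L x * L y * s x y.
  case: (pselect (x = y)) => [->|xy]; first by rewrite rxx sxx mulr0.
  have [|k [k_neq0]] := equiv a b x y.
    by split=> -[]; congruence.
  rewrite rab sab !mul1r => -> e1 e2; congr (_ * _).
  (* at least one of the other two cross ratio entries does not vanish *)
  case: (pselect (x = a \/ y = b)) => [xa_or_yb|].
    have /eqP m_neq0 : s a y * s b x != 0.
      rewrite mulf_neq0// gt_eqF// s_gt0// => E; case: xa_or_yb => E'; congruence.
    apply: (mulIf (introN eqP m_neq0)); rewrite -e2 raE rbE; ring.
  move=> /not_orP[xa yb].
  have m_neq0 : s a x * s b y != 0.
    by rewrite mulf_neq0// gt_eqF// s_gt0//; exact: nesym.
  by apply: (mulIf m_neq0); rewrite -e1 raE rbE; ring.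
have L_le1 d : L d <= 1.
  have := s_ultra a d b; rewrite sab le_max => /orP[] s_ge1.
    apply: le_trans (r_le1 a d); rewrite raE.
    by rewrite ler_peMr// ltW.
  apply: le_trans (r_le1 b d); rewrite rbE.
  by rewrite ler_peMr 1?s_sym ?(ltW (L_gt0 d)).
have L1 d : L d = 1.
  apply/eqP; rewrite eq_le L_le1 /=; have [d'] := r_anti d.
  rewrite rE -mulrA => <-; rewrite ler_piMr ?(ltW (L_gt0 _))//.
  have s_ge0 : 0 <= s d d'.
    by case: (pselect (d = d')) => [->|/s_gt0/ltW//]; rewrite sxx.
  by rewrite mulr_ile1// ?s_le1// ltW.
by move=> x y; rewrite rE !L1 !mul1r.
Qed.

End MoebiusEquivalence.

(** * Transport along a bijection *)

Section Pullback.
Context {R : realType} {Z Y : Type}.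
Implicit Types (phi : Z -> Y) (rho : Y -> Y -> \bar R).

Lemma antipodal_pullback phi rho : bijective phi ->
  antipodal_diameter1 rho -> antipodal_diameter1 (pullback_metric phi rho).
Proof.
move=> [psi phiK psiK] [[rho_fin rho0 rho_sym rho_tri] rho_sup rho_anti].
split; rewrite /pullback_metric.
- split=> [x y _ _|x y _ _|x y _ _|x y z _ _ _].
  + exact: rho_fin.
  + by rewrite rho0//; split=> [/(can_inj phiK)|->].
  + exact: rho_sym.
  + exact: rho_tri.
- rewrite -rho_sup; congr ereal_sup; apply/seteqP.
  split=> _ [[p q] _ <-] /=; first by exists (phi p, phi q).
  by exists (psi p, psi q) => //=; rewrite !psiK.
- move=> z; have [y zy] := rho_anti (phi z).
  by exists (psi y); rewrite psiK.
Qed.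

Lemma dist_Ma1_pullback phi rho1 rho2 : bijective phi ->
  dist_Ma1 (pullback_metric phi rho1) (pullback_metric phi rho2) =
  dist_Ma1 rho1 rho2.
Proof.
move=> [psi phiK psiK]; rewrite /dist_Ma1; congr ereal_sup.
have derivE z :
    moebius_deriv (pullback_metric phi rho1) (pullback_metric phi rho2) z =
    moebius_deriv rho1 rho2 (phi z).
  rewrite /moebius_deriv; congr xget; apply/seteqP.
  split=> r rE eta eta' etaz eta'z etas; last first.
    by apply: rE => /(can_inj phiK).
  have := rE (psi eta) (psi eta'); rewrite /pullback_metric !psiK; apply.
  - by move=> E; apply: etaz; rewrite -E psiK.
  - by move=> E; apply: eta'z; rewrite -E psiK.
  - by move=> /(can_inj psiK).
apply/seteqP; split=> _ [z _ <-]; first by exists (phi z); rewrite ?derivE.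
by exists (psi z); rewrite ?derivE ?psiK.
Qed.

End Pullback.

(** * Bourdon metrics *)

Section BourdonMetrics.
Context {R : realType} {X : metricType R}.
Context (X_tree : is_tree X).
Implicit Types (x y p : X) (a b c : boundary X).

Lemma bourdonxx x a : bourdon x a a = 0%E.
Proof. by rewrite /bourdon; case: asboolP. Qed.

Lemma bourdon_neq x a b : a <> b ->
  bourdon x a b = (expR (- boundary_product x a b))%:E.
Proof. by move=> ab; rewrite /bourdon; case: asboolP. Qed.

Lemma fine_bourdon_ge0 x a b : 0 <= fine (bourdon x a b).
Proof. by rewrite /bourdon; case: asboolP => //= _; exact: expR_ge0. Qed.

Lemma fine_bourdon_le1 x a b : fine (bourdon x a b) <= 1.
Proof.
rewrite /bourdon; case: asboolP => //= ab.
by rewrite expR_le1 oppr_le0 boundary_product_ge0.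
Qed.

Lemma fine_bourdon_ultra x a b c : fine (bourdon x a c) <=
  Num.max (fine (bourdon x a b)) (fine (bourdon x b c)).
Proof.
case: (pselect (a = c)) => [->|ac]; first by rewrite bourdonxx le_max fine_bourdon_ge0.
case: (pselect (a = b)) => [->|ab]; first by rewrite le_max lexx orbT.
case: (pselect (b = c)) => [->|bc]; first by rewrite le_max lexx.
rewrite !bourdon_neq//= le_max !ler_expR !lerN2.
have [le_ab|/ltW le_bc] := leP (boundary_product x a b) (boundary_product x b c).
  by rewrite (boundary_product_ultra X_tree ab bc ac (lexx _) le_ab).
by rewrite (boundary_product_ultra X_tree ab bc ac le_bc (lexx _)) orbT.
Qed.

Lemma bourdon_metric x : metric_on [set: boundary X] (bourdon x).
Proof.
have bourdonE a b : bourdon x a b = (fine (bourdon x a b))%:E.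
  by rewrite /bourdon; case: asboolP.
split=> [a b _ _|a b _ _|a b _ _|a b c _ _ _].
- by rewrite bourdonE lee_fin fine_bourdon_ge0 ltry.
- split=> [|->]; last exact: bourdonxx.
  rewrite /bourdon; case: asboolP => // _ [] /eqP.
  by rewrite gt_eqF// expR_gt0.
- case: (pselect (a = b)) => [->//|ab]; rewrite !bourdon_neq//; last exact: nesym.
  by rewrite (boundary_product_sym X_tree).
- rewrite (bourdonE a c) (bourdonE a b) (bourdonE b c) -EFinD lee_fin.
  apply: (le_trans (fine_bourdon_ultra x a b c)).
  by rewrite ge_max lerDl lerDr !fine_bourdon_ge0.
Qed.

Lemma bourdon_conformal x y a b : fine (bourdon x a b) =
  expR (- busemann x y a / 2) * expR (- busemann x y b / 2) * fine (bourdon y a b).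
Proof.
case: (pselect (a = b)) => [->|ab]; first by rewrite !bourdonxx mulr0.
rewrite !bourdon_neq//= -!expRD (boundary_product_busemann X_tree x y)//.
by congr expR; lra.
Qed.

Lemma bourdon_moebius_equiv x y : moebius_equiv (bourdon x) (bourdon y).
Proof.
apply: (conformal_moebius_equiv (bourdon_metric x) (bourdon_metric y) _
  (bourdon_conformal x y)) => a.
by rewrite gt_eqF// expR_gt0.
Qed.

Lemma bourdon_structure x : boundary_structure X (bourdon x).
Proof.
by exists x => //; split; [exact/metric_on_extended/bourdon_metric|].
Qed.

Lemma moebius_deriv_bourdon x y a b c : a <> b -> b <> c -> a <> c ->
  moebius_deriv (bourdon x) (bourdon y) a = expR (busemann x y a).
Proof.
move=> ab bc ac; rewrite /moebius_deriv.
have derivE eta eta' : eta <> a -> eta' <> a -> eta <> eta' ->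
    expR (busemann x y a) =
    fine (bourdon x eta eta') / (fine (bourdon x a eta) * fine (bourdon x a eta')) *
    (fine (bourdon y a eta) * fine (bourdon y a eta') / fine (bourdon y eta eta')).
  move=> /nesym aeta /nesym aeta' etas.
  rewrite !bourdon_neq//= -!expRD -!expRN -!expRD; congr expR.
  rewrite !(boundary_product_busemann X_tree x y)//; lra.
case: xgetP => [r _ /(_ b c) rE|/(_ _ derivE)//].
by rewrite rE -?derivE//; exact: nesym.
Qed.

Lemma dist_Ma1_bourdon x y a b c : geodesically_complete X ->
  a <> b -> b <> c -> a <> c ->
  dist_Ma1 (bourdon x) (bourdon y) = (mdist x y)%:E.
Proof.
move=> X_gc ab bc ac.
have derivE d : moebius_deriv (bourdon x) (bourdon y) d = expR (busemann x y d).
  case: (pselect (d = a)) => [->|da]; first exact: (moebius_deriv_bourdon _ _ ab bc ac).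
  case: (pselect (d = b)) => [->|db].
    exact: (moebius_deriv_bourdon _ _ (nesym ab) ac bc).
  exact: (moebius_deriv_bourdon _ _ da ab db).
apply/eqP; rewrite eq_le; apply/andP; split.
  apply: ge_ereal_sup => _ [d _ <-].
  by rewrite derivE expRK lee_fin (busemann_le X_tree).
have [d <-] : exists d, busemann x y d = mdist x y.
  case: (pselect (x = y)) => [->|/ray_extension]; last exact.
  by exists a; rewrite mdistxx; have := busemann_anti X_tree y y a; lra.
by apply: ereal_sup_ubound; exists d => //; rewrite derivE expRK.
Qed.

Lemma bourdon_antipodal x a : geodesically_complete X ->
  antipodal_diameter1 (bourdon x).
Proof.
move=> X_gc; have antipode b : exists c, bourdon x b c = 1%E.
  have [c bc xbc] := antipode_exists X_tree X_gc x b.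
  by exists c; rewrite bourdon_neq// xbc oppr0 expR0.
split=> //; first exact: bourdon_metric.
apply/eqP; rewrite eq_le; apply/andP; split.
  apply: ge_ereal_sup => _ [[b c] _ <-] /=.
  by rewrite (metric_on_fin (bourdon_metric x)) lee_fin fine_bourdon_le1.
have [b ab1] := antipode a.
by apply: ereal_sup_ubound; exists (a, b).
Qed.

(** Take [a], [b] at [rho]-distance 1 and a third point [c].  The Bourdon metric
    at any point of the line from [a] to [b] gives [a], [b] distance 1, and
    moving the point along the line multiplies the quotient of the distances
    from [c] to [a] and [b] by any prescribed number. *)
Lemma antipodal_bourdon o rho : (exists a b c, [/\ a <> b, b <> c & a <> c]) ->
  moebius_equiv (bourdon o) rho -> antipodal_diameter1 rho ->
  exists x, rho = bourdon x.
Proof.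
move=> [a [b0 [c0 [ab0 bc0 ac0]]]] equiv rho_anti.
have [mrho _ rho_anti1] := rho_anti; have [rho_ge0 rho0 _ _] := mrho.
have [b rab] := rho_anti1 a.
have ab : a <> b.
  move=> ab; move: rab; rewrite ab (rho0 b b I I).2// => -[] /eqP.
  by rewrite eq_sym oner_eq0.
have [c ca cb] : exists2 c, c <> a & c <> b.
  case: (pselect (b0 = b)) => [b0b|]; last by exists b0 => //; exact: nesym.
  by exists c0; rewrite -?b0b; exact: nesym.
have r_gt0 d : c <> d -> 0 < fine (rho d c).
  move=> cd; rewrite lt_neqAle eq_sym -lee_fin -(metric_on_fin mrho).
  have /andP[-> _] := rho_ge0 d c I I; rewrite andbT; apply/eqP => dc.
  by apply: cd; apply/esym/rho0; rewrite // (metric_on_fin mrho) dc.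
have [p pab] := line_point_exists X_tree o ab.
pose t := boundary_product p b c - boundary_product p a c
  - ln (fine (rho a c) / fine (rho b c)).
have [x [pxa pxb]] := line_point_shift X_tree t ab pab.
have xE d d' : d <> d' -> boundary_product x d d' =
    boundary_product p d d' - (busemann p x d + busemann p x d') / 2.
  move=> dd'; rewrite (boundary_product_busemann X_tree x p)//.
  by rewrite !(busemann_anti X_tree p x); lra.
exists x; apply: (antipodal_rigidity rho_anti (bourdon_metric x) _ _ _ ca cb).
- exact: fine_bourdon_le1.
- exact: fine_bourdon_ultra.
- exact: moebius_equiv_trans (bourdon_moebius_equiv x o) equiv.
- by rewrite rab.
- rewrite bourdon_neq//= xE// pab pxa pxb.
  by rewrite (_ : - _ = 0) ?expR0//; lra.
- rewrite !bourdon_neq//=; [|exact: nesym..].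
  rewrite -[fine (rho a c)]lnK ?posrE ?r_gt0// -[fine (rho b c)]lnK ?posrE ?r_gt0//.
  rewrite -!expRD; congr expR; rewrite !xE; [|exact: nesym..].
  by rewrite pxa pxb /t ln_div ?posrE ?r_gt0//; lra.
Qed.

End BourdonMetrics.

(** * The isometry onto the antipodal metrics of diameter 1 *)

Theorem theorem5p1 (R : realType) (Z : Type) (M : set (Z -> Z -> \bar R))
    (M_moebius : moebius_space M) (M_ultra : ultrametric_structure M)
    (X : metricType R) (X_tree : is_tree X) (X_gc : geodesically_complete X)
    (phi : Z -> boundary X)
    (phi_id : moebius_identification phi M (boundary_structure X)) :
  let i := fun x : X => pullback_metric phi (bourdon x) in
  set_bij [set: X] (Ma1 M) i /\
  (forall x y : X, dist_Ma1 (i x) (i y) = (mdist x y)%:E).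
Proof.
move=> i; have [phi_bij ->] := phi_id; have [psi phiK psiK] := phi_bij.
have [[a [b [c [ab bc ac]]]] _] := M_moebius.
have phi_neq z w : z <> w -> phi z <> phi w by move=> zw /(can_inj phiK).
have i_dist x y : dist_Ma1 (i x) (i y) = (mdist x y)%:E.
  rewrite dist_Ma1_pullback//.
  by rewrite (dist_Ma1_bourdon X_tree x y X_gc (phi_neq _ _ ab) (phi_neq _ _ bc)
    (phi_neq _ _ ac)).
split=> //; split.
- move=> x _; split.
    by exists (bourdon x) => //; exact: bourdon_structure.
  exact: antipodal_pullback phi_bij (bourdon_antipodal X_tree x (phi a) X_gc).
- move=> x y _ _ ixy; apply/mdist_eq0; rewrite -lee_fin -i_dist ixy i_dist.
  by rewrite mdistxx.
- move=> _ [[rho [p _ [_ rho_equiv]] <-] rho_anti].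
  have {}rho_anti : antipodal_diameter1 rho.
    rewrite (_ : rho = pullback_metric psi (pullback_metric phi rho)).
      by apply: antipodal_pullback => //; exists phi.
    by apply/funext => x; apply/funext => y; rewrite /pullback_metric !psiK.
  have [|x ->] := antipodal_bourdon X_tree _ rho_equiv rho_anti; last by exists x.
  by exists (phi a), (phi b), (phi c); split; exact: phi_neq.
Qed.
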